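(* For every $C>0$ and every $\varepsilon>0$ there exist constants $p_0$ and $c>0$, depending only on $C$ and $\varepsilon$, such that for every prime $p\ge p_0$, every integer $M$ with $1\le M\le p$ and $M\le C p^{1/8}$, every integer $\lambda$ with $\gcd(\lambda,p)=1$, and every integer $L$, $$I_3(M;L)\le c\,M^{\varepsilon}.$$
   Context: For a prime $p$, integers $L,\lambda$ with $\gcd(\lambda,p)=1$ and an integer $1\le M\le p$, $I_3(M;L)$ denotes the number of triples of integers $(x,y,z)$ with $xyz\equiv\lambda\pmod p$ and $L+1\le x,y,z\le L+M$. *)

(* Defs.v *)
From mathcomp Require Import all_boot all_order all_algebra.
From mathcomp Require Import reals exp.

Set Implicit Arguments.
Unset Strict Implicit.
Unset Printing Implicit Defensive.

Import Order.TTheory GRing.Theory Num.Theory.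
Local Open Scope ring_scope.

(* The integers of [L + 1, L + M] are enumerated without repetition as
   L + 1 + i with i : 'I_M; below, i.+1%:Z is the offset from L. *)
Definition I3 (p M : nat) (lambda L : int) : nat :=
  #|[set t : 'I_M * 'I_M * 'I_M |
      ((L + (t.1.1).+1%:Z) * (L + (t.1.2).+1%:Z) * (L + (t.2).+1%:Z)
         == lambda %[mod p%:Z])%Z]|.

(* Main.v *)
Require Import Defs.
From mathcomp Require Import all_boot all_order all_algebra.
From mathcomp Require Import reals exp.
From mathcomp Require Import zify ring lra.

Import Order.TTheory GRing.Theory Num.Theory.
Local Open Scope ring_scope.

(** Cut [[L + 1, L + M]] into [K] pieces of length [m], with [K] a constant
    depending only on [C], and count the solutions lying in one cell, that is,
    with each coordinate in a prescribed piece.  To a solution attach the cubic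
    [(X + x) (X + y) (X + z)]; the difference of two such cubics in the same
    cell is a quadratic [w X^2 + v X + u] with [w = O(m)], [v = O(M m)],
    [u = O(M^2 m)], and it vanishes at [L] modulo [p].
    - If two of these differences are not proportional, their resultant is
      divisible by [p] and is [O(M^4 m^4) = O(M^8 / K^4)], so it is zero; they
      have a common rational root [b / a], and so do all the differences (a
      determinant divisible by [p] is too small not to vanish).  Hence
      [(a x - b) (a y - b) (a z - b)] is constant on the cell.
    - If all are proportional to one quadratic [Q], then [Q(-x) Q(-y) Q(-z)]
      is constant.  Should it be zero, [Q] has a root [-x] coming from a
      solution; as [L + x] is invertible modulo [p], the other linear factor
      of [Q] vanishes at [L] and plays the role of [a X - b] above.
    - If all are zero, [x y z] is constant.
    In every case [f(x) f(y) f(z) = N] with [f] of degree 1 or 2 and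
    [0 < |N| = O(M^12)], so the divisor bound leaves [O(M^eps)] solutions. *)

(** * The divisor bound *)

Section DivisorBound.
Local Open Scope nat_scope.

(** A divisor [d] of [a * b] is recovered from [gcdn d a], which divides [a], and [d %/ gcdn d a],
    which divides [b]; no coprimality is involved. *)
Lemma size_divisorsM (a b : nat) : 0 < a -> 0 < b ->
  size (divisors (a * b)) <= size (divisors a) * size (divisors b).
Proof.
move=> a_gt0 b_gt0.
rewrite -(size_allpairs muln); apply: uniq_leq_size; first exact: divisors_uniq.
move=> d; rewrite -dvdn_divisors ?muln_gt0 ?a_gt0 // => d_ab.
have d_gt0 : 0 < d by apply: dvdn_gt0 d_ab; rewrite muln_gt0 a_gt0.
have g_gt0 : 0 < gcdn d a by rewrite gcdn_gt0 d_gt0.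
apply/allpairsP; exists (gcdn d a, d %/ gcdn d a); split => /=.
- by rewrite -dvdn_divisors // dvdn_gcdr.
- rewrite -dvdn_divisors // -(@Gauss_dvdr _ (a %/ gcdn d a)).
    by rewrite -(dvdn_pmul2l g_gt0) mulnA ![gcdn d a * _]mulnC !divnK
      ?dvdn_gcdl ?dvdn_gcdr.
  rewrite /coprime -(eqn_pmul2l g_gt0) muln_gcdr ![gcdn d a * _]mulnC.
  by rewrite !divnK ?dvdn_gcdl ?dvdn_gcdr // mul1n.
- by rewrite mulnC divnK // dvdn_gcdl.
Qed.

Lemma size_divisors_pfactor (p e : nat) : prime p ->
  size (divisors (p ^ e)) <= e.+1.
Proof.
move=> p_pr; rewrite -[e.+1](size_iota 0) -(size_map (expn p) (iota 0 e.+1)).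
apply: uniq_leq_size; first exact: divisors_uniq.
move=> d; rewrite -dvdn_divisors ?expn_gt0 ?prime_gt0 //.
case/(dvdn_pfactor _ _ p_pr) => i i_le ->.
by apply: map_f; rewrite mem_iota.
Qed.

(** Obtained by raising [e.+1 <= k * 2 ^ (e %/ k)] to the power [k]. It serves for the small primes
    [p], where [2 ^ e <= p ^ e], at the cost of the constant [k ^ k]. *)
Lemma expS_le_exp2 (k e : nat) : 0 < k -> e.+1 ^ k <= k ^ k * 2 ^ e.
Proof.
move=> k_gt0; have e_le : e.+1 <= k * 2 ^ (e %/ k).
  apply: leq_trans (_ : k * (e %/ k).+1 <= _); first by rewrite mulnC ltn_ceil.
  by rewrite leq_mul2l ltn_expl ?orbT.
apply: leq_trans (_ : (k * 2 ^ (e %/ k)) ^ k <= _); first by rewrite leq_exp2r.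
by rewrite expnMn -expnM leq_mul2l leq_exp2l // leq_trunc_div orbT.
Qed.

(* Only the primes below [2 ^ k] contribute to the constant, because
   [(e + 1) ^ k <= p ^ e] for [p >= 2 ^ k]. *)
Lemma size_divisors_exp_le (k : nat) : 0 < k ->
  exists2 c, 0 < c & forall n, 0 < n -> size (divisors n) ^ k <= c * n.
Proof.
move=> k_gt0; pose c0 := k ^ k.
have c0_gt0 : 0 < c0 by rewrite expn_gt0 k_gt0.
exists (c0 ^ (2 ^ k)); first by rewrite expn_gt0 c0_gt0.
(* Induction on a strict bound [B] for the prime factors. Splitting off the power of the prime [B]
   costs a factor [c0] only when [B < 2 ^ k], whence the exponent [minn B (2 ^ k)]. *)
suff main B n : 0 < n -> (forall p, prime p -> p %| n -> p < B) ->
    size (divisors n) ^ k <= c0 ^ minn B (2 ^ k) * n.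
  move=> n n_gt0; apply: leq_trans (main n.+1 n n_gt0 _) _.
    by move=> p _ /dvdn_leq; apply.
  by rewrite leq_mul2r leq_pexp2l ?orbT // geq_minr.
elim: B n => [|B IH] n n_gt0 n_lt.
  have [n_le1|n_gt1] := leqP n 1.
    have -> : n = 1 by apply/eqP; rewrite eqn_leq n_le1.
    by rewrite exp1n muln1 expn_gt0 c0_gt0.
  by have := n_lt _ (pdiv_prime n_gt1) (pdiv_dvd n).
have min_le : minn B (2 ^ k) <= minn B.+1 (2 ^ k).
  by rewrite leq_min geq_minr andbT (leq_trans (geq_minl _ _)).
have [B_pr|B_npr] := boolP (prime B); last first.
  apply: leq_trans (IH n n_gt0 _) _.
    move=> p p_pr p_n; rewrite ltn_neqAle -ltnS n_lt // andbT.
    by apply: contraNneq B_npr => <-.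
  by rewrite leq_mul2r leq_pexp2l ?orbT.
have [m B'm def_n] := pfactor_coprime B_pr n_gt0.
set f := logn B n in def_n.
have m_gt0 : 0 < m by case: (posnP m) def_n n_gt0 => // -> ->.
have Bf_gt0 : 0 < B ^ f by rewrite expn_gt0 prime_gt0.
have {}IH := IH m m_gt0.
have m_lt p : prime p -> p %| m -> p < B.
  move=> p_pr p_m; rewrite ltn_neqAle -ltnS n_lt ?def_n ?dvdn_mulr // andbT.
  by apply: contraTneq p_m => ->; rewrite -prime_coprime.
apply: leq_trans (_ : (size (divisors m) * f.+1) ^ k <= _).
  rewrite leq_exp2r // {1}def_n (leq_trans (size_divisorsM _ _ m_gt0 Bf_gt0)) //.
  by rewrite leq_mul2l size_divisors_pfactor ?orbT.
have [B_ge|B_lt] := leqP (2 ^ k) B.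
  have f_le : f.+1 ^ k <= B ^ f.
    apply: leq_trans (_ : (2 ^ f) ^ k <= _); first by rewrite leq_exp2r // ltn_expl.
    by rewrite -expnM mulnC expnM; case: (f) => // f'; rewrite leq_exp2r.
  rewrite expnMn [in leqRHS]def_n mulnA leq_mul // (leq_trans (IH m_lt)) //.
  by rewrite leq_mul2r leq_pexp2l ?orbT.
rewrite expnMn [in leqRHS]def_n.
have -> : minn B.+1 (2 ^ k) = (minn B (2 ^ k)).+1.
  by rewrite (minn_idPl B_lt) (minn_idPl (ltnW B_lt)).
rewrite expnSr mulnACA leq_mul ?IH // (leq_trans (expS_le_exp2 _ _ k_gt0)) //.
rewrite leq_mul2l; apply/orP; right.
by case: (f) => // f'; rewrite leq_exp2r // prime_gt1.
Qed.
End DivisorBound.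

(** * Size estimates and small residues *)

Lemma ler_normM {a b A B : int} : `|a| <= A -> `|b| <= B -> `|a * b| <= A * B.
Proof. by move=> aA bB; rewrite normrM ler_pM. Qed.

Lemma ler_normD2 {a b A B : int} : `|a| <= A -> `|b| <= B -> `|a + b| <= A + B.
Proof. by move=> aA bB; rewrite (le_trans (ler_normD _ _)) // lerD. Qed.

Lemma ler_normB2 {a b A B : int} : `|a| <= A -> `|b| <= B -> `|a - b| <= A + B.
Proof. by move=> aA bB; rewrite (le_trans (ler_normB _ _)) // lerD. Qed.

(** Every passage from a congruence modulo [p] to an equality of integers goes through this fact. *)
Lemma pchar_small_eq0 (F : fieldType) (p : nat) (n B : int) :
  p \in [pchar F] -> `|n| <= B -> B < p%:Z -> n%:~R = 0 :> F -> n = 0.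
Proof.
move=> pF nB Bp /eqP; rewrite -(dvdz_pcharf pF) dvdzE /= => p_n.
apply/eqP; rewrite -absz_eq0; case: posnP => // n_gt0.
have := dvdn_leq n_gt0 p_n; lia.
Qed.

(** * Symmetric functions, quadratics and resultants *)

Definition esym1 (x y z : int) : int := x + y + z.
Definition esym2 (x y z : int) : int := x * y + y * z + z * x.
Definition esym3 (x y z : int) : int := x * y * z.

Definition quad (A B D x : int) : int := A * x ^+ 2 + B * x + D.

(** Changing one factor at a time leaves a coordinate difference in each term, so that the bound is
    of order [M * m] instead of [M ^ 2]. *)
Lemma esym2B (x y z x' y' z' : int) :
  esym2 x y z - esym2 x' y' z' =
  (x * (y - y') + y' * (x - x')) + (y * (z - z') + z' * (y - y'))
  + (z * (x - x') + x' * (z - z')).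
Proof. by rewrite /esym2; ring. Qed.

Lemma esym3B (x y z x' y' z' : int) :
  esym3 x y z - esym3 x' y' z' =
  x * y * (z - z') + x * z' * (y - y') + y' * z' * (x - x').
Proof. by rewrite /esym3; ring. Qed.

(* The product of the values of a quadratic at the three roots of a monic
   cubic is a resultant, hence unchanged when a multiple of the quadratic is
   added to the cubic. *)
Lemma quad_prod_invariant (w v u x y z x' y' z' : int) (t : rat) :
  (esym1 x' y' z' - esym1 x y z)%:~R = t * w%:~R ->
  (esym2 x' y' z' - esym2 x y z)%:~R = t * v%:~R ->
  (esym3 x' y' z' - esym3 x y z)%:~R = t * u%:~R ->
  quad w (- v) u x' * quad w (- v) u y' * quad w (- v) u z' =
  quad w (- v) u x * quad w (- v) u y * quad w (- v) u z.
Proof.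
(* The product of [w X^2 - v X + u] over three values of [X], in terms of their elementary symmetric
   functions. The sign of [v] reflects that the cubics have roots [-x], [-y], [-z]. *)
pose Res (e1 e2 e3 w v u : rat) : rat := w^+3 * e3^+2 - w^+2 * v * e3 * e2
  + w^+2 * u * (e2^+2 - 2 * e1 * e3) + w * v^+2 * e1 * e3
  - w * v * u * (e1 * e2 - 3 * e3) + w * u^+2 * (e1^+2 - 2 * e2)
  - v^+3 * e3 + v^+2 * u * e2 - v * u^+2 * e1 + u^+3.
have ResE a b c : (quad w (- v) u a * quad w (- v) u b * quad w (- v) u c)%:~R
    = Res (esym1 a b c)%:~R (esym2 a b c)%:~R (esym3 a b c)%:~R w%:~R v%:~R u%:~R.
  by rewrite /Res /quad /esym1 /esym2 /esym3; ring.
rewrite !rmorphB /= => /(canRL (subrK _)) E1 /(canRL (subrK _)) E2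
  /(canRL (subrK _)) E3.
apply: (@intr_inj rat); rewrite !ResE E1 E2 E3 /Res; ring.
Qed.

Lemma proportional (w v u w' v' u' : int) :
  [|| w != 0, v != 0 | u != 0] ->
  w * v' = w' * v -> w * u' = w' * u -> v * u' = v' * u ->
  exists t : rat, [/\ w'%:~R = t * w%:~R, v'%:~R = t * v%:~R & u'%:~R = t * u%:~R].
Proof.
move=> nz /(congr1 (intr : int -> rat)); rewrite !rmorphM /= => Ea.
move=> /(congr1 (intr : int -> rat)); rewrite !rmorphM /= => Eb.
move=> /(congr1 (intr : int -> rat)); rewrite !rmorphM /= => Ec.
case/or3P: nz; rewrite -(intr_eq0 rat) => nz.
- by exists (w'%:~R / w%:~R); split; apply: (mulIf nz); rewrite [RHS]mulrAC divfK //; lra.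
- by exists (v'%:~R / v%:~R); split; apply: (mulIf nz); rewrite [RHS]mulrAC divfK //; lra.
- by exists (u'%:~R / u%:~R); split; apply: (mulIf nz); rewrite [RHS]mulrAC divfK //; lra.
Qed.

(** * Structure of the solutions in one cell *)

Lemma cell_structure (F : fieldType) (p M m : nat) (L lam : F)
    (T : finType) (S : {set T}) (x y z : T -> int) :
  p \in [pchar F] -> lam != 0 -> (0 < M)%N -> (m <= M)%N ->
  1620 * M%:Z ^+ 4 * m%:Z ^+ 4 < p%:Z ->
  (forall s, s \in S -> [/\ 1 <= x s <= M%:Z, 1 <= y s <= M%:Z & 1 <= z s <= M%:Z]) ->
  (forall s, s \in S -> (L + (x s)%:~R) * (L + (y s)%:~R) * (L + (z s)%:~R) = lam) ->
  (forall s t, s \in S -> t \in S ->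
     [/\ `|x s - x t| <= m%:Z, `|y s - y t| <= m%:Z & `|z s - z t| <= m%:Z]) ->
  exists A B D N : int, [/\ (A != 0) || (B != 0), N != 0, `|N| <= (54 * M%:Z ^+ 4) ^+ 3
    & forall s, s \in S -> quad A B D (x s) * quad A B D (y s) * quad A B D (z s) = N].
Proof.
move=> pF lam_neq0 M_gt0 mM small rangeS solS diffS.
have Mge1 : 1 <= M%:Z by lia.
(* The condition [0 < j] matters when [m = 0]: then [m ^+ j <= m ^+ 4] fails for [j = 0]. *)
have small0 (n k : int) (i j : nat) : [&& 0 < j, i <= 4 & j <= 4]%N -> 0 <= k <= 1620 ->
    `|n| <= k * M%:Z ^+ i * m%:Z ^+ j -> n%:~R = 0 :> F -> n = 0.
  move=> /and3P[j_gt0 i4 j4] /andP[k_ge0 k_le] n_le.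
  apply: pchar_small_eq0 pF (le_trans n_le _) small.
  have mj : m%:Z ^+ j <= m%:Z ^+ 4.
    have [->|m_gt0] := posnP m; first by rewrite !expr0n gtn_eqF.
    by rewrite ler_weXn2l // lez_nat.
  have Mi : M%:Z ^+ i <= M%:Z ^+ 4 by rewrite ler_weXn2l.
  by rewrite !ler_pM // ?mulr_ge0 // exprn_ge0.
have M4 (i : nat) : (i <= 4)%N -> M%:Z ^+ i <= M%:Z ^+ 4.
  by move=> i4; rewrite ler_weXn2l.
have mM4 (i : nat) : (i <= 3)%N -> M%:Z ^+ i * m%:Z <= M%:Z ^+ 4.
  by move=> i3; rewrite (le_trans _ (M4 i.+1 i3)) // exprSr ler_wpM2l ?exprn_ge0 //.
have [S0|[s0 s0S]] := set_0Vmem S.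
  exists 0, 1, 0, 1; split => //; last by move=> s; rewrite S0 inE.
  have := M4 0%N isT; rewrite expr0 normr1 => M4_ge1.
  by rewrite exprn_ege1 //; lia.
have prodN (A B D K : int) s : s \in S -> K <= 54 * M%:Z ^+ 4 ->
    (forall a : int, 1 <= a <= M%:Z -> `|quad A B D a| <= K) ->
    `|quad A B D (x s) * quad A B D (y s) * quad A B D (z s)| <= (54 * M%:Z ^+ 4) ^+ 3.
  move=> sS K_le bd; case: (rangeS s sS) => xs ys zs.
  rewrite exprS expr2 mulrA; do 2?apply: ler_normM; exact: le_trans (bd _ _) K_le.
have unitS s : s \in S -> [/\ L + (x s)%:~R != 0, L + (y s)%:~R != 0 & L + (z s)%:~R != 0].
  move=> /solS sol_s; move: lam_neq0; rewrite -sol_s !mulf_eq0 !negb_or.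
  by case/andP => /andP[].
(* The coefficients of the cubic of [s] minus that of a fixed [s0]. Both cubics take the value [lam]
   at [L], so this difference vanishes there. *)
pose d1 s := esym1 (x s) (y s) (z s) - esym1 (x s0) (y s0) (z s0).
pose d2 s := esym2 (x s) (y s) (z s) - esym2 (x s0) (y s0) (z s0).
pose d3 s := esym3 (x s) (y s) (z s) - esym3 (x s0) (y s0) (z s0).
have d1_le s : s \in S -> `|d1 s| <= 3 * m%:Z.
  move=> sS; case: (diffS s s0 sS s0S); rewrite /d1 /esym1; lia.
have normM a : 1 <= a <= M%:Z -> `|a| <= M%:Z by lia.
have d2_le s : s \in S -> `|d2 s| <= 6 * M%:Z * m%:Z.
  move=> sS; case: (diffS s s0 sS s0S) => dx dy dz.
  case: (rangeS s sS) => /normM xs /normM ys /normM zs.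
  case: (rangeS s0 s0S) => /normM x0 /normM y0 /normM z0.
  rewrite /d2 esym2B.
  have -> : 6 * M%:Z * m%:Z = (M%:Z * m%:Z + M%:Z * m%:Z) + (M%:Z * m%:Z + M%:Z * m%:Z)
    + (M%:Z * m%:Z + M%:Z * m%:Z) by ring.
  by rewrite !(ler_normD2, ler_normM).
have d3_le s : s \in S -> `|d3 s| <= 3 * M%:Z ^+ 2 * m%:Z.
  move=> sS; case: (diffS s s0 sS s0S) => dx dy dz.
  case: (rangeS s sS) => /normM xs /normM ys /normM zs.
  case: (rangeS s0 s0S) => /normM x0 /normM y0 /normM z0.
  rewrite /d3 esym3B.
  have -> : 3 * M%:Z ^+ 2 * m%:Z = M%:Z * M%:Z * m%:Z + M%:Z * M%:Z * m%:Z
    + M%:Z * M%:Z * m%:Z by ring.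
  by rewrite !(ler_normD2, ler_normM).
have rootL s : s \in S -> (d1 s)%:~R * L ^+ 2 + (d2 s)%:~R * L + (d3 s)%:~R = 0 :> F.
  move=> sS; have := solS s sS; rewrite -(solS s0 s0S) => /eqP.
  rewrite -subr_eq0 => /eqP <-; rewrite /d1 /d2 /d3 /esym1 /esym2 /esym3; ring.
have [s1 /andP[s1S /= nz]|d0] := pickP [pred s in S |
    [|| d1 s != 0, d2 s != 0 | d3 s != 0]]; last first.
  exists 0, 1, 0, (esym3 (x s0) (y s0) (z s0)); split => //.
  - by case: (rangeS s0 s0S) => xs ys zs; rewrite /esym3 !mulf_neq0 //; lia.
  - have := prodN 0 1 0 M%:Z s0 s0S; rewrite /quad !mul0r !add0r !mul1r !addr0; apply.
      have := M4 1%N isT; lia.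
    by move=> a; rewrite mul0r add0r mul1r addr0; apply: normM.
  - move=> s sS; have := d0 s; rewrite /= sS /= => /negbT.
    rewrite !negb_or !negbK => /and3P[_ _]; rewrite subr_eq0 => /eqP <-.
    by rewrite /quad /esym3; ring.
set w := d1 s1 in nz; set v := d2 s1 in nz; set u := d3 s1 in nz.
have w_le := d1_le s1 s1S; have v_le := d2_le s1 s1S; have u_le := d3_le s1 s1S.
have rootQ := rootL s1 s1S.
rewrite -/w -/v -/u in w_le v_le u_le rootQ.
clearbody w v u.
have [s2 /andP[s2S /= nz2]|prop] := pickP [pred s in S |
    [|| w * d2 s - d1 s * v != 0, w * d3 s - d1 s * u != 0 | v * d3 s - d2 s * u != 0]].
  pose w2 := d1 s2; pose v2 := d2 s2; pose u2 := d3 s2.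
  have w2_le := d1_le s2 s2S; have v2_le := d2_le s2 s2S.
  have u2_le := d3_le s2 s2S; have rootQ2 := rootL s2 s2S.
  rewrite -/w2 -/v2 -/u2 in nz2 w2_le v2_le u2_le rootQ2.
  clearbody w2 v2 u2.
  (* [(a, - b, c)] is the cross product of the coefficient vectors, proportional
     to [(1, L, L ^ 2)] modulo [p]; the resultant is [b ^ 2 - a * c]. *)
  pose a := w * v2 - w2 * v; pose b := w * u2 - w2 * u; pose c := v * u2 - v2 * u.
  have a_le : `|a| <= 36 * M%:Z ^+ 1 * m%:Z ^+ 2.
    have := ler_normB2 (ler_normM w_le v2_le) (ler_normM w2_le v_le).
    by congr (_ <= _); ring.
  have b_le : `|b| <= 18 * M%:Z ^+ 2 * m%:Z ^+ 2.
    have := ler_normB2 (ler_normM w_le u2_le) (ler_normM w2_le u_le).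
    by congr (_ <= _); ring.
  have c_le : `|c| <= 36 * M%:Z ^+ 3 * m%:Z ^+ 2.
    have := ler_normB2 (ler_normM v_le u2_le) (ler_normM v2_le u_le).
    by congr (_ <= _); ring.
  have u_eq : u%:~R = - (w%:~R * L ^+ 2 + v%:~R * L).
    by apply/eqP; rewrite -addr_eq0 addrC rootQ.
  have u2_eq : u2%:~R = - (w2%:~R * L ^+ 2 + v2%:~R * L).
    by apply/eqP; rewrite -addr_eq0 addrC rootQ2.
  have bL : b%:~R = - (a%:~R * L) by rewrite /a /b !(rmorphB, rmorphM) /= u_eq u2_eq; ring.
  have cL : c%:~R = a%:~R * L ^+ 2 by rewrite /a /c !(rmorphB, rmorphM) /= u_eq u2_eq; ring.
  rewrite -/a -/b -/c in nz2; clearbody a b c.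
  have b2_ac : b ^+ 2 = a * c.
    apply/eqP; rewrite -subr_eq0; apply/eqP.
    (* Here 1620 is 18 * 18 + 36 * 36, from the bounds on [b], [a] and [c]. *)
    apply: (small0 _ 1620 4%N 4%N isT); first by clear; lia.
      rewrite expr2.
      have := ler_normB2 (ler_normM b_le b_le) (ler_normM a_le c_le).
      by congr (_ <= _); ring.
    by rewrite rmorphB rmorphXn rmorphM /= bL cL; ring.
  have a_neq0 : a != 0.
    apply/eqP => a0; have b0 : b = 0 by apply/eqP; rewrite -sqrf_eq0 b2_ac a0 mul0r.
    have c0 : c = 0.
      apply: (small0 _ 36 3%N 2%N isT _ c_le); first by clear; lia.
      by rewrite cL a0 mul0r.
    by move: nz2; rewrite a0 b0 c0 eqxx.
  have aF_neq0 : a%:~R != 0 :> F.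
    apply: contra a_neq0 => /eqP aF0; apply/eqP.
    by apply: (small0 _ 36 1%N 2%N isT _ a_le aF0); clear; lia.
  (* Modulo [p] this determinant is [a] times the value at [L] of the difference attached to [s];
     its size constant is 324 = 3 * 36 + 6 * 18 + 3 * 36. *)
  have det0 s : s \in S -> d3 s * a - d2 s * b + d1 s * c = 0.
    move=> sS; apply: (small0 _ 324 3%N 3%N isT); first by clear; lia.
      have := ler_normD2 (ler_normB2 (ler_normM (d3_le s sS) a_le)
        (ler_normM (d2_le s sS) b_le)) (ler_normM (d1_le s sS) c_le).
      by congr (_ <= _); ring.
    move: (rootL s sS); move: (d1 s) (d2 s) (d3 s) => e1 e2 e3 rL.
    rewrite !(rmorphB, rmorphD, rmorphM) /= bL cL.
    transitivity (a%:~R * (e1%:~R * L ^+ 2 + e2%:~R * L + e3%:~R)); first by ring.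
    by rewrite rL mulr0.
  exists 0, a, (- b),
    (quad 0 a (- b) (x s0) * quad 0 a (- b) (y s0) * quad 0 a (- b) (z s0)).
  split; first by rewrite a_neq0 orbT.
  (* In [F], [a x - b] equals [a (L + x)], so the product is a product of units. *)
  - have [ux uy uz] := unitS s0 s0S.
    have := mulf_neq0 (mulf_neq0 (mulf_neq0 aF_neq0 ux) (mulf_neq0 aF_neq0 uy))
      (mulf_neq0 aF_neq0 uz).
    apply: contra => /eqP/(congr1 (intr : int -> F)) E0; apply/eqP.
    rewrite -[RHS]E0 /quad !(rmorphD, rmorphN, rmorphM, rmorph0) /= bL; ring.
  - apply: (prodN _ _ _ (54 * M%:Z ^+ 4)) => // e /normM e_le.
    rewrite /quad mul0r add0r.
    apply: le_trans (ler_normB2 (ler_normM a_le e_le) b_le) _.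
    have -> : 36 * M%:Z ^+ 1 * m%:Z ^+ 2 * M%:Z + 18 * M%:Z ^+ 2 * m%:Z ^+ 2 =
      54 * (M%:Z ^+ 2 * m%:Z ^+ 2) by ring.
    by rewrite ler_pM2l // (exprD _ 2 2) ler_pM2l ?exprn_gt0 ?lerXn2r ?nnegrE ?ltz_nat.
  - move=> s sS.
    have quadE X Y Z : quad 0 a (- b) X * quad 0 a (- b) Y * quad 0 a (- b) Z
        = a ^+ 2 * (esym3 X Y Z * a - esym2 X Y Z * b) + esym1 X Y Z * a * b ^+ 2 - b ^+ 3.
      by rewrite /quad /esym1 /esym2 /esym3; ring.
    (* Replacing [b ^+ 2] by [a * c] turns the difference of the two products into [a ^+ 2] times
       the vanishing determinant. *)
    apply/eqP; rewrite -subr_eq0 !quadE b2_ac.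
    apply/eqP; transitivity (a ^+ 2 * (d3 s * a - d2 s * b + d1 s * c)).
      by rewrite /d1 /d2 /d3; ring.
    by rewrite det0 ?mulr0.
have propS s : s \in S -> exists t : rat, [/\ (d1 s)%:~R = t * w%:~R,
    (d2 s)%:~R = t * v%:~R & (d3 s)%:~R = t * u%:~R].
  move=> sS; apply: proportional nz _ _ _; have := prop s; rewrite /= sS /= => /negbT;
    by rewrite !negb_or !negbK !subr_eq0 => /and3P[/eqP E1 /eqP E2 /eqP E3].
have lin (e : int) : 1 <= e <= M%:Z -> L + e%:~R != 0 -> quad w (- v) u e = 0 ->
    exists A B D N : int, [/\ (A != 0) || (B != 0), N != 0, `|N| <= (54 * M%:Z ^+ 4) ^+ 3
    & forall s, s \in S -> quad A B D (x s) * quad A B D (y s) * quad A B D (z s) = N].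
  (* The root [e] gives the factorization [w X^2 - v X + u = (X - e) (w X - b)]. At [X = -L] the
     left side vanishes in [F] and [L + e] is a unit, so [b] equals [- w L] there. *)
  move=> e_range e_unit Qe0; pose b := v - w * e.
  have uE : u = e * b by move: Qe0; rewrite /quad /b; lia.
  have vE : v = b + w * e by rewrite /b; ring.
  clearbody b.
  have bL : b%:~R = - (w%:~R * L) :> F.
    apply/eqP; rewrite -addr_eq0 -(mulrI_eq0 _ (mulfI e_unit)) -rootQ uE vE; apply/eqP.
    by rewrite rmorphD !rmorphM /=; ring.
  have wF_neq0 : w%:~R != 0 :> F.
    apply: contraTneq nz => wF0.
    have w0 : w = 0.
      apply: (small0 _ 3 0%N 1%N isT _ _ wF0); first by clear; lia.
      by rewrite expr0 mulr1.
    have b0 : b = 0.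
      apply: (small0 _ 6 1%N 1%N isT); first by clear; lia.
        by move: v_le; rewrite vE w0 mul0r addr0.
      by rewrite bL wF0 mul0r oppr0.
    by rewrite uE vE w0 b0 mul0r mulr0 addr0 eqxx.
  have w_neq0 : w != 0 by apply: contraNneq wF_neq0 => ->.
  exists 0, w, (- b),
    (quad 0 w (- b) (x s0) * quad 0 w (- b) (y s0) * quad 0 w (- b) (z s0)).
  split; first by rewrite w_neq0 orbT.
  - have [ux uy uz] := unitS s0 s0S.
    have := mulf_neq0 (mulf_neq0 (mulf_neq0 wF_neq0 ux) (mulf_neq0 wF_neq0 uy))
      (mulf_neq0 wF_neq0 uz).
    apply: contra => /eqP/(congr1 (intr : int -> F)) E0; apply/eqP.
    rewrite -[RHS]E0 /quad !(rmorphD, rmorphN, rmorphM, rmorph0) /= bL; ring.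
  - apply: (prodN _ _ _ (54 * M%:Z ^+ 4)) => // f /normM f_le.
    (* This form is bounded by the known estimates on [w] and [v]. *)
    have -> : quad 0 w (- b) f = w * (f + e) - v by rewrite /quad vE; ring.
    apply: le_trans (ler_normB2 (ler_normM w_le
      (ler_normD2 f_le (normM _ e_range))) v_le) _.
    have := mM4 1%N isT; rewrite expr1; lia.
  - move=> s sS; have [t [E1 E2 E3]] := propS s sS.
    have quadE X Y Z : quad 0 w (- b) X * quad 0 w (- b) Y * quad 0 w (- b) Z
        = w ^+ 3 * esym3 X Y Z - w ^+ 2 * b * esym2 X Y Z
          + w * b ^+ 2 * esym1 X Y Z - b ^+ 3.
      by rewrite /quad /esym1 /esym2 /esym3; ring.
    apply/eqP; rewrite -subr_eq0 !quadE.
    rewrite -(intr_eq0 rat); apply/eqP.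
    (* The symmetric function differences are [t] times [(w, v, u)], and this combination vanishes
       because [w X - b] divides [w X^2 - v X + u]. *)
    transitivity (w%:~R ^+ 3 * (d3 s)%:~R - w%:~R ^+ 2 * b%:~R * (d2 s)%:~R
      + w%:~R * b%:~R ^+ 2 * (d1 s)%:~R : rat); first by rewrite /d1 /d2 /d3; ring.
    by rewrite E1 E2 E3 uE vE; ring.
have [|] := boolP [exists s in S, (quad w (- v) u (x s) == 0)
    || (quad w (- v) u (y s) == 0) || (quad w (- v) u (z s) == 0)].
  case/exists_inP => s sS; case: (rangeS s sS) (unitS s sS) => xs ys zs [ux uy uz].
  by case/orP => [/orP[]|] /eqP; apply: lin.
move=> noroot.
exists w, (- v), u, (quad w (- v) u (x s0) * quad w (- v) u (y s0) * quad w (- v) u (z s0)).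
split.
(* If [w] and [v] vanished, [u] would be zero in [F], hence zero by its size, against [nz]. *)
- rewrite oppr_eq0; apply: contraT; rewrite negb_or !negbK => /andP[/eqP w0 /eqP v0].
  move: nz; rewrite w0 v0 eqxx /= => /negP; case; apply/eqP.
  apply: (small0 _ 3 2%N 1%N isT _ u_le); first by clear; lia.
  by move: rootQ; rewrite w0 v0 !mul0r !add0r.
- apply: contra noroot; rewrite !mulf_eq0 => s0_root.
  by apply/exists_inP; exists s0.
- apply: (prodN _ _ _ (54 * M%:Z ^+ 4)) => // f /normM f_le.
  rewrite /quad expr2; apply: le_trans (ler_normD2 (ler_normD2
    (ler_normM w_le (ler_normM f_le f_le)) (ler_normM (_ : `|- v| <= _) f_le)) u_le) _.
    by rewrite normrN; exact: v_le.
  have := mM4 2%N isT; rewrite expr2; lia.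
- move=> s sS; have [t [E1 E2 E3]] := propS s sS.
  exact: quad_prod_invariant E1 E2 E3.
Qed.

(** * Counting the solutions of a product equation *)

Lemma card_quad_fiber (T : finType) (x : T -> int) (A B D d : int) :
  injective x -> (A != 0) || (B != 0) -> (#|[set t | quad A B D (x t) == d]| <= 2)%N.
Proof.
move=> x_inj AB; rewrite leqNgt; apply/card_gt2P => -[i [j [k [[]]]]].
rewrite !inE /quad => /eqP fi /eqP fj /eqP fk [ij jk ki].
have key a b : a != b -> A * x a ^+ 2 + B * x a + D = d -> A * x b ^+ 2 + B * x b + D = d ->
    A * (x a + x b) + B = 0.
  move=> ab <- /eqP; rewrite -subr_eq0 => /eqP E.
  have : x b - x a != 0 by rewrite subr_eq0 (inj_eq x_inj) eq_sym.
  by move=> /mulfI; apply; rewrite mulr0 -[RHS]E; ring.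
have := key _ _ ij fi fj; have := key _ _ jk fj fk => Ejk Eij.
have A0 : A = 0.
  have /mulIf : x i - x k != 0 by rewrite subr_eq0 (inj_eq x_inj) eq_sym.
  by apply; rewrite mul0r -[RHS](subrr 0) -{1}Eij -Ejk; ring.
by move: AB Ejk; rewrite A0 mul0r add0r eqxx /= => /eqP.
Qed.

(** The factor 4 accounts for two signs of each divisor and two preimages of each value. *)
Lemma card_quad_dvd (T : finType) (x : T -> int) (A B D N : int) :
  injective x -> (A != 0) || (B != 0) -> N != 0 ->
  (#|[set t | (quad A B D (x t) %| N)%Z]| <= 4 * size (divisors `|N|))%N.
Proof.
move=> x_inj AB N_neq0; 
pose fib d := [set t | quad A B D (x t) == d].
have sub : [set t | (quad A B D (x t) %| N)%Z] \subset
    \bigcup_(d <- divisors `|N|) (fib d%:Z :|: fib (- d%:Z)).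
  apply/subsetP => t; rewrite inE dvdzE => d_N.
  rewrite (big_rem `|quad A B D (x t)|%N) /=; last by rewrite -dvdn_divisors ?absz_gt0.
  rewrite !inE; move: (quad A B D (x t)) => q.
  by rewrite (_ : (q == _) || _) //; lia.
apply: leq_trans (subset_leq_card sub) _.
elim: (divisors _) => [|d l IH]; first by rewrite big_nil cards0.
rewrite big_cons /= mulnS (leq_trans (leq_card_setU _ _)) // leq_add //.
rewrite (leq_trans (leq_card_setU _ _)) // -[4%N]/(2 + 2)%N.
by rewrite leq_add // card_quad_fiber.
Qed.

Lemma card_quad_prod (M : nat) (S : {set 'I_M * 'I_M * 'I_M}) (A B D N : int) :
  (A != 0) || (B != 0) -> N != 0 ->
  (forall t, t \in S -> quad A B D t.1.1.+1%:Z * quad A B D t.1.2.+1%:Z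
     * quad A B D t.2.+1%:Z = N) ->
  (#|S| <= (4 * size (divisors `|N|)) ^ 3)%N.
Proof.
move=> AB N_neq0 prodS.
pose V := [set i : 'I_M | (quad A B D i.+1%:Z %| N)%Z].
have V_le : (#|V| <= 4 * size (divisors `|N|))%N.
  by apply: card_quad_dvd => // i j [] /val_inj.
have : S \subset setX (setX V V) V.
  apply/subsetP => -[[i j] k] /prodS /= E; rewrite !inE /= -E.
  apply/andP; split; last exact: dvdz_mull.
  by apply/andP; split; [rewrite -mulrA dvdz_mulr | rewrite mulrAC dvdz_mull].
move/subset_leq_card/leq_trans; apply.
by rewrite !cardsX expnSr leq_mul // expnS expn1 leq_mul.
Qed.

(** * Summation over the cells and choice of parameters *)

(** Taking a [k]-th power keeps the divisor bound within [nat]. The exponent 36 is 3 * 12, for three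
    coordinates and [N] of order [M ^ 12], and does not depend on [k]. *)
Lemma I3_exp_le (k K : nat) : (0 < k)%N -> (0 < K)%N ->
  exists C0 : nat, forall (p M : nat) (lambda L : int),
    prime p -> (0 < M)%N -> 1620 * M%:Z ^+ 4 * (M %/ K)%N%:Z ^+ 4 < p%:Z ->
    coprimez lambda p%:Z -> (I3 p M lambda L ^ k <= C0 * M ^ 36)%N.
Proof.
move=> k_gt0 K_gt0; have [c c_gt0 tau_le] := size_divisors_exp_le k k_gt0.
exists ((K * K * K) ^ k * ((4 ^ k) ^ 3 * (c * 54 ^ 3) ^ 3))%N.
move=> p M lambda L p_pr M_gt0 small lam_p.
pose m := (M %/ K)%N.
(* Blocks have [m.+1] elements: [K] of them cover [M] indices, and two indices in one block differ
   by at most [m]. *)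
have cell_lt (i : 'I_M) : (i %/ m.+1 < K)%N.
  by rewrite ltn_divLR // mulnC (ltn_trans (ltn_ord i)) // ltn_ceil.
pose cell i := Ordinal (cell_lt i).
have cellP (i j : nat) : (i %/ m.+1 = j %/ m.+1)%N -> `|i.+1%:Z - j.+1%:Z| <= m%:Z.
  have := divn_eq i m.+1; have := divn_eq j m.+1.
  have := ltn_pmod i (ltn0Sn m); have := ltn_pmod j (ltn0Sn m).
  by move=> mj mi Ej Ei E; rewrite Ei Ej E; lia.
have pF := pchar_Fp p_pr.
have lam_neq0 : lambda%:~R != 0 :> 'F_p.
  rewrite -(dvdz_pcharf pF) dvdzE /= -prime_coprime //.
  by move: lam_p; rewrite coprimez_sym coprimezE.
pose S := [set t : 'I_M * 'I_M * 'I_M | ((L + (t.1.1).+1%:Z) * (L + (t.1.2).+1%:Z)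
  * (L + (t.2).+1%:Z) == lambda %[mod p%:Z])%Z].
pose cells (t : 'I_M * 'I_M * 'I_M) := (cell t.1.1, cell t.1.2, cell t.2).
have cell_le a : (#|[set t in S | cells t == a]| ^ k <=
    (4 ^ k) ^ 3 * (c * 54 ^ 3) ^ 3 * M ^ 36)%N.
  have [||||A [B [D [N [AB N_neq0 N_le prodN]]]]] :=
    cell_structure _ p M m L%:~R lambda%:~R _
    [set t in S | cells t == a] (fun t => t.1.1.+1%:Z) (fun t => t.1.2.+1%:Z)
    (fun t => t.2.+1%:Z) pF lam_neq0 M_gt0 _ small.
  - exact: leq_div.
  - by move=> t _; rewrite !lez_nat !ltn_ord.
  - move=> t; rewrite !inE => /andP[+ _]; rewrite eqz_mod_dvd (dvdz_pcharf pF).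
    by rewrite rmorphB /= subr_eq0 !(rmorphD, rmorphM) /= => /eqP.
  - move=> s t; rewrite !inE => /andP[_ /eqP <-] /andP[_ /eqP[E1 E2 E3]].
    by split; apply: cellP.
  have := card_quad_prod _ _ _ _ _ _ AB N_neq0 prodN.
  rewrite -(leq_exp2r _ _ k_gt0) => /leq_trans; apply.
  rewrite -expnM [(3 * k)%N]mulnC expnM (expnMn 4) (expnMn (4 ^ k)).
  rewrite -mulnA leq_mul2l; apply/orP; right.
  have -> : (M ^ 36 = (M ^ 12) ^ 3)%N by rewrite -expnM.
  rewrite -expnMn leq_exp2r // (leq_trans (tau_le _ _)) ?absz_gt0 // -mulnA leq_mul2l.
  rewrite (_ : 54 ^ 3 * M ^ 12 = (54 * M ^ 4) ^ 3)%N; last by rewrite expnMn -expnM.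
  by rewrite -lez_nat abszE -[X in _ <= X]natz natrX natrM natrX (natz M) N_le orbT.
have -> : I3 p M lambda L = (\sum_a #|[set t in S | cells t == a]|)%N.
  rewrite /I3 -/S -sum1_card (partition_big cells xpredT) //=.
  by apply: eq_bigr => a _; rewrite -sum1_card; apply: eq_bigl => t; rewrite !inE.
(* The sum is bounded by the number of cells times its largest term, since the available estimate
   concerns the [k]-th power of each term. *)
pose mx := (\max_a #|[set t in S | cells t == a]|)%N.
apply: leq_trans (_ : ((K * K * K) * mx) ^ k <= _)%N.
  rewrite leq_exp2r // (_ : (K * K * K)%N = #|{: 'I_K * 'I_K * 'I_K}|);
    last by rewrite !card_prod card_ord.
  by rewrite -sum_nat_const leq_sum // => a _; apply: leq_bigmax.
rewrite expnMn -[leqRHS]mulnA leq_mul2l; apply/orP; right; rewrite /mx.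
have [|a ->] := bigop.eq_bigmax
  (fun a : 'I_K * 'I_K * 'I_K => #|[set t in S | cells t == a]|).
  by rewrite !card_prod card_ord !muln_gt0 K_gt0.
exact: cell_le.
Qed.

Theorem theorem2 (R : realType) (C eps : R) (hC : 0 < C) (heps : 0 < eps) :
  exists (p0 : nat) (c : R), 0 < c /\
    forall (p M : nat) (lambda L : int),
      prime p -> (p0 <= p)%N ->
      (1 <= M <= p)%N -> M%:R <= C * (p%:R `^ (8%:R^-1)) ->
      coprimez lambda p%:Z ->
      (I3 p M lambda L)%:R <= c * (M%:R `^ eps).
Proof.
(* [k] makes [36 / k < eps], and [K] makes [1620 * M ^ 8 / K ^ 4] smaller than [p] when
   [M ^ 8 <= C ^ 8 * p]. *)
pose k := (Num.truncn (36 / eps)).+1; pose K := (Num.truncn (1620 * C ^+ 8)).+1.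
have k_gt : 36 < eps * k%:R by rewrite mulrC -ltr_pdivrMr // truncnS_gt.
have K_gt : 1620 * C ^+ 8 < K%:R ^+ 4.
  apply: lt_le_trans (truncnS_gt _) _.
  by rewrite -/K -natrX ler_nat -[leqLHS]expn1 leq_pexp2l.
have [C0 I3_le] := I3_exp_le k K isT isT.
(* Adding 1 makes the constant positive and at least 1, so that its [k]-th power dominates [C0]. *)
exists 0%N, (C0%:R + 1); split; first by rewrite ltr_wpDl.
move=> p M lambda L p_pr _ /andP[M_gt0 _] M_le lam_p.
have p_gt0 : 0 < p%:R :> R by rewrite ltr0n prime_gt0.
have M8 : M%:R ^+ 8 <= C ^+ 8 * p%:R :> R.
  have -> : C ^+ 8 * p%:R = (C * p%:R `^ 8%:R^-1) ^+ 8.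
    by rewrite exprMn -(powR_mulrn _ (powR_ge0 _ _)) -powRrM mulVf ?pnatr_eq0 //
      powRr1 // ltW.
  by rewrite lerXn2r ?nnegrE // mulr_ge0 ?powR_ge0 // ltW.
have small : 1620 * M%:Z ^+ 4 * (M %/ K)%N%:Z ^+ 4 < p%:Z.
  rewrite -(ltr_int R) !(rmorphM, rmorphXn) /= -!pmulrn.
  rewrite -(@ltr_pM2r _ (K%:R ^+ 4)) ?exprn_gt0 ?ltr0n // -[ltLHS]mulrA -exprMn.
  have mK : (M %/ K)%N%:R * K%:R <= M%:R :> R by rewrite -natrM ler_nat leq_divM.
  apply: le_lt_trans (_ : 1620 * C ^+ 8 * p%:R < _); last by rewrite mulrC ltr_pM2l.
  rewrite -[leLHS]mulrA -[leRHS]mulrA ler_pM2l // (le_trans _ M8) //.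
  rewrite (exprD _ 4 4) ler_wpM2l ?exprn_ge0 //.
  by rewrite lerXn2r ?nnegrE ?mulr_ge0.
have := I3_le p M lambda L p_pr M_gt0 small lam_p.
rewrite -(ler_nat R) natrX natrM natrX => I3k.
have Meps : M%:R ^+ 36 <= (M%:R `^ eps) ^+ k :> R.
  rewrite -powR_mulrn ?ler0n // -(powR_mulrn _ (powR_ge0 _ _)) -powRrM.
  by rewrite ler_powR ?ler1n // ltW.
have C0k : C0%:R <= (C0%:R + 1) ^+ k :> R.
  apply: le_trans (_ : C0%:R + 1 <= _); first by rewrite lerDl.
  by rewrite ler_eXnr // lerDr.
rewrite -(@ler_pXn2r _ k) // ?nnegrE ?mulr_ge0 ?powR_ge0 ?addr_ge0 //.
by rewrite exprMn (le_trans I3k) // ler_pM ?exprn_ge0.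
Qed.
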